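(* Let $\pi\in B_n$. Then $\pi$ has a unique presentation of the form $$\pi=u_1\cdot v_1\cdot u_2\cdot v_2\cdots v_{r-1}\cdot u_r$$ for some $r\ge1$, such that the following hold: - $u_j\in\dot S_n$ for every $1\le j\le r$; - $v_j=\tau_{p_j}^{p_j}$ for $1\le j\le r-1$, where $p_j>p_{j'}$ for $j>j'$; - for every $1\le j\le r$, either $u_j=1$ or the generalized standard $OGS$ presentation of $u_j$ is $u_j=\tau_{p_{j_1}}^{i_{p_{j_1}}}\cdots\tau_{p_{j_{z_j}}}^{i_{p_{j_{z_j}}}}$, where $p_{j_1}\ge p_{j-1}$ for every $2\le j\le r$, and $p_{j_{z_j}}\le p_j$ for every $1\le j\le r-1$.
   Context: $B_n$ is the group of signed permutations, i.e. the bijections $\pi$ of $\{\pm1,\dots,\pm n\}$ with $\pi(-i)=-\pi(i)$. It is a Coxeter group with generators $s_0,\dots,s_{n-1}$, where $s_0$ exchanges $1$ and $-1$, and for $1\le i\le n-1$, $s_i$ exchanges $i$ with $i+1$ and $-i$ with $-(i+1)$. Products are read from left to right: $(\pi_1\cdot\pi_2)(i)=\pi_2(\pi_1(i))$. $\dot S_n$ is the subgroup of $B_n$ generated by $s_1,\dots,s_{n-1}$. For $1\le k\le n$, $\tau_k=s_0s_1\cdots s_{k-1}$. Every element of $B_n$ has a unique presentation $\tau_1^{i_1}\cdots\tau_n^{i_n}$ with integers $-k\le i_k<k$, called its generalized standard $OGS$ presentation; it is written omitting trivial factors, i.e. with strictly increasing subscripts (here $p_{j_1}<\dots<p_{j_{z_j}}$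 are the subscripts occurring in $u_j$) and nonzero exponents. *)

(* Defs.v *)
From mathcomp Require Import all_boot all_order all_algebra all_fingroup.

Set Implicit Arguments.
Unset Strict Implicit.
Unset Printing Implicit Defensive.

Import GroupScope.

(* The set {1, ..., n, -1, ..., -n}: (false, i) stands for i + 1 and (true, i)
   for - (i + 1).                                                            *)
Notation letter n := (bool * 'I_n)%type.

Definition lopp (n : nat) (x : letter n) : letter n := (~~ x.1, x.2).

(* The product of {perm _} composes from left to right:
   (s * t) x = t (s x) (lemma permM).                                        *)
Definition Bn (n : nat) : {set {perm letter n}} :=
  [set s : {perm letter n} | [forall x, s (lopp x) == lopp (s x)]].

Lemma Bn_group_set (n : nat) : group_set (Bn n).
Proof.
apply/group_setP; split; first by rewrite inE; apply/forallP=> x; rewrite !perm1.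
move=> s t; rewrite !inE => /forallP sP /forallP tP; apply/forallP=> x.
by rewrite !permM (eqP (sP x)) (eqP (tP _)).
Qed.
Canonical Bn_group (n : nat) : {group {perm letter n}} := Group (Bn_group_set n).

Definition ordpred (n : nat) (i : 'I_n) : 'I_n :=
  Ordinal (leq_ltn_trans (leq_pred i) (ltn_ord i)).

(* With 0-based indices, the letters i and i + 1 exchanged by s_i (i > 0) have
   indices i - 1 and i.                                                      *)
Definition cgen (n : nat) (i : 'I_n) : {perm letter n} :=
  if i == 0%N :> nat then tperm (false, i) (true, i)
  else tperm (false, ordpred i) (false, i)
       * tperm (true, ordpred i) (true, i).

Definition dotS (n : nat) : {group {perm letter n}} :=
  <<[set cgen i | i in [pred i : 'I_n | 0 < i]]>>%G.

(* s_0 s_1 ... s_(k-1), meant for 1 <= k <= n.                               *)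
Definition tau (n k : nat) : {perm letter n} := \prod_(i < n | i < k) cgen i.

Definition expgz (gT : finGroupType) (x : gT) (m : int) : gT :=
  match m with Posz k => x ^+ k | Negz k => x ^- k.+1 end.

(* w lists the pairs (subscript, exponent) of the nontrivial factors of the
   generalized standard OGS presentation of g; g = 1 corresponds to w = [::]. *)
Definition gsOGS (n : nat) (g : {perm letter n}) (w : seq (nat * int)) : Prop :=
  [/\ sorted ltn (unzip1 w),
      forall f, f \in w ->
        [/\ 0 < f.1 <= n, (- (f.1%:Z) <= f.2 < f.1%:Z)%R & f.2 != 0%R]
    & g = \prod_(f <- w) expgz (tau n f.1) f.2].

(* us = [:: u_1; ...; u_r] and ps = [:: p_1; ...; p_(r-1)], so that u_(j+1) is
   nth 1 us j and p_(j+1) is nth 0 ps j; the size condition forces r >= 1.   *)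
Definition uv_presentation (n : nat) (g : {perm letter n})
    (us : seq {perm letter n}) (ps : seq nat) : Prop :=
  let u j := nth 1 us j in
  let p j := nth 0%N ps j in
  let v j := tau n (p j) ^+ p j in
  let r := size us in
  [/\ r = (size ps).+1,
      g = (\prod_(0 <= j < r.-1) (u j * v j)) * u r.-1,
      forall j, j < r -> u j \in dotS n,
      (forall j, j < r.-1 -> 0 < p j <= n)
        /\ (forall i j, i < j < r.-1 -> p i < p j)
    & forall j, j < r ->
        u j = 1 \/
        exists f w, [/\ gsOGS (u j) (f :: w),
                        0 < j -> p j.-1 <= f.1
                      & j < r.-1 -> (last f w).1 <= p j]].

(* Main.v *)
(* Place the letters in the cyclic order 1, ..., n, -1, ..., -n. On the letters
   of absolute value at most k, tau_k is the shift of their cyclic order, so an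
   element has an OGS presentation with subscripts in [p, q] if and only if it
   fixes the letters beyond q and preserves the cyclic order on +-1, ..., +-p;
   for an element of \dot S_n, the latter means being increasing on 1, ..., p.
   Moreover tau_p^p negates 1, ..., p. Hence p_(r-1) is the largest i such that
   pi(i) < 0, and u_r is the representative of a coset of \dot S_p that is
   increasing on 1, ..., p; stripping v_(r-1) u_r leaves an element of B_p to
   which the same argument applies. *)

Require Import Defs.
From mathcomp Require Import all_boot all_order all_algebra all_fingroup.
From mathcomp Require Import zify.

Set Implicit Arguments.
Unset Strict Implicit.
Unset Printing Implicit Defensive.

Import GroupScope.

Ltac if_lia := repeat case: ifP => ?; lia.

Lemma letterP n (x y : letter n) : x.1 = y.1 -> x.2 = y.2 :> nat -> x = y.
Proof. by case: x y => [a i] [b j] /= -> /val_inj ->. Qed.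

Lemma BnP n (g : {perm letter n}) :
  reflect (forall x, g (lopp x) = lopp (g x)) (g \in Bn n).
Proof. by rewrite inE; apply: (iffP forallP) => H x; apply/eqP; rewrite H. Qed.
Arguments BnP {n g}.

Lemma Bn_index n (g : {perm letter n}) b i :
  g \in Bn n -> (g (b, i)).2 = (g (false, i)).2.
Proof.
by move=> /BnP gP; case: b => //; rewrite -[(true, i)]/(lopp (false, i)) gP.
Qed.

Lemma Bn_sign n (g : {perm letter n}) b i :
  g \in Bn n -> (g (b, i)).1 = b (+) (g (false, i)).1.
Proof.
by move=> /BnP gP; case: b => //; rewrite -[(true, i)]/(lopp (false, i)) gP.
Qed.

(** * Parabolic subgroups and the cyclic order *)

(** The copy of $B_k$ inside $B_n$, written as a pointwise stabilizer so that its group structure is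
    inferred. *)
Definition parab n k : {set {perm letter n}} :=
  'C_(Bn n)([set x : letter n | k <= x.2] | 'P).
Canonical parab_group n k := [group of parab n k].

Lemma parabP n k (g : {perm letter n}) :
  reflect (g \in Bn n /\ forall x : letter n, k <= x.2 -> g x = x)
    (g \in parab n k).
Proof.
apply: (iffP setIP) => [[-> /astabP H]|[-> H]]; split=> //.
  by move=> x kx; apply: (H x); rewrite inE.
by apply/astabP=> x; rewrite inE; apply: H.
Qed.
Arguments parabP {n k g}.

Lemma parab_Bn n k (g : {perm letter n}) : g \in parab n k -> g \in Bn n.
Proof. by case/parabP. Qed.

Lemma parab_lt n k (g : {perm letter n}) (x : letter n) :
  g \in parab n k -> x.2 < k -> (g x).2 < k.
Proof.
move=> /parabP[_ gP] xk; rewrite ltnNge; apply/negP=> kgx.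
by have gx := perm_inj (gP _ kgx); rewrite gx leqNgt xk in kgx.
Qed.

Lemma parab_full n (g : {perm letter n}) : (g \in parab n n) = (g \in Bn n).
Proof.
apply/idP/idP=> [/parab_Bn //|gB]; apply/parabP; split=> // x.
by rewrite leqNgt ltn_ord.
Qed.

Lemma parabS n k l (g : {perm letter n}) :
  k <= l -> g \in parab n k -> g \in parab n l.
Proof.
move=> kl /parabP[gB gP]; apply/parabP; split=> // x lx.
exact/gP/(leq_trans kl).
Qed.

Lemma parab0 n (g : {perm letter n}) : g \in parab n 0 -> g = 1.
Proof. by case/parabP=> _ gP; apply/permP=> x; rewrite perm1 gP. Qed.

(* For [y <> x, -x]: [y] follows [x] by less than half a turn in the cyclic
   order 1, ..., n, -1, ..., -n. *)
Definition cyc n (x y : letter n) := (x.2 < y.2) (+) x.1 (+) y.1.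

Definition cyc_mono n p (g : {perm letter n}) :=
  forall x y : letter n, x.2 < p -> y.2 < p -> cyc (g x) (g y) = cyc x y.

(** A group, so that membership of [tau n k] yields that of all its powers, negative ones
    included. *)
Definition rotgp n k : {set {perm letter n}} :=
  [set g in parab n k | [forall x : letter n, forall y : letter n,
    (x.2 < k) ==> (y.2 < k) ==> (cyc (g x) (g y) == cyc x y)]].

Lemma rotgpP n k (g : {perm letter n}) :
  reflect (g \in parab n k /\ cyc_mono k g) (g \in rotgp n k).
Proof.
apply: (iffP setIdP) => [[-> H]|[-> H]]; split=> //.
  move=> x y xk yk; apply/eqP.
  by have /forallP/(_ y) := forallP H x; rewrite xk yk.
apply/forallP=> x; apply/forallP=> y; apply/implyP=> xk; apply/implyP=> yk.
exact/eqP/H.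
Qed.
Arguments rotgpP {n k g}.

Lemma rotgp_group_set n k : group_set (rotgp n k).
Proof.
apply/group_setP; split.
  by apply/rotgpP; split; [exact: group1 | move=> x y _ _; rewrite !perm1].
move=> g h /rotgpP[gB gP] /rotgpP[hB hP]; apply/rotgpP.
split; first exact: groupM.
by move=> x y xk yk; rewrite !permM hP ?gP // (parab_lt gB).
Qed.
Canonical rotgp_group n k := Group (rotgp_group_set n k).

(** The bound for [h] is [k] rather than [p], since [g] may move the first [p] letters anywhere
    among the first [k]. *)
Lemma cyc_monoM n p k (g h : {perm letter n}) :
  p <= k -> g \in parab n k -> cyc_mono p g -> cyc_mono k h ->
  cyc_mono p (g * h).
Proof.
move=> pk gB gP hP x y xp yp.
by rewrite !permM hP ?gP // (parab_lt gB) // (leq_trans _ pk).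
Qed.

(** * The elements tau_k *)

Lemma cgen0E n (i : 'I_n) (x : letter n) :
  i = 0 :> nat -> cgen i x = (x.1 (+) (x.2 == i), x.2).
Proof.
move=> i0; rewrite /cgen i0 eqxx; case: x => b j /=.
case: tpermP => [[-> ->]|[-> ->]|]; rewrite ?eqxx //.
by case: eqP => [->|_]; rewrite ?addbF //; case: b.
Qed.

Lemma cgenSE n (i : 'I_n) (x : letter n) :
  0 < i -> cgen i x = (x.1, tperm (ordpred i) i x.2).
Proof.
move=> i0; rewrite /cgen -[_ == 0]negbK -lt0n i0 /= permM.
have inj b : injective (pair b : 'I_n -> letter n) by move=> ? ? [].
case: x => [[] j] /=.
  by rewrite (tpermD (z := (true, j))) // -(inj_tperm _ _ _ (inj true)).
have := inj_tperm (ordpred i) i j (inj false); rewrite /= => <-.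
by rewrite (tpermD (z := (false, _))).
Qed.

Lemma cgen_Bn n (i : 'I_n) : cgen i \in Bn n.
Proof.
apply/BnP=> x; have [i0|i0] := posnP i; last by rewrite !cgenSE.
by rewrite !cgen0E //= addNb.
Qed.

Lemma tau0 n : tau n 0 = 1.
Proof. exact: big_pred0. Qed.

Lemma tauS n k (kn : k < n) : tau n k.+1 = tau n k * cgen (Ordinal kn).
Proof.
rewrite /tau (big_ord_narrow kn) big_ord_recr (big_ord_narrow (ltnW kn)) /=.
congr (_ * _); last by congr cgen; apply: val_inj.
by apply: eq_bigr => i _; congr cgen; apply: val_inj.
Qed.

Lemma tau_Bn n k : tau n k \in Bn n.
Proof. by apply: group_prod => i _; apply: cgen_Bn. Qed.

(** Reading from left to right, the letter of index 0 is negated by $s_0$ and then carried up to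
    index $k-1$ by $s_1,\dots,s_{k-1}$; a letter of index $i$ with $0<i<k$ is moved only by $s_i$,
    one place down. *)
Lemma tauE n k (x : letter n) : k <= n ->
  (tau n k x).1 = x.1 (+) ((x.2 == 0 :> nat) && (0 < k)) /\
  (tau n k x).2 = (if x.2 < k then if x.2 == 0 :> nat then k.-1 else x.2.-1
                   else x.2) :> nat.
Proof.
elim: k => [|k IH] kn; first by rewrite tau0 perm1 andbF addbF.
have [IH1 IH2] := IH (ltnW kn); rewrite (tauS kn) permM.
case: k kn IH1 IH2 {IH} => [|k] kn IH1 IH2.
  rewrite tau0 perm1 cgen0E //=; split; first by rewrite -val_eqE andbT.
  by case: (val x.2).
rewrite cgenSE //= IH1; split=> //.
set a := nat_of_ord x.2 in IH2 *.
case: tpermP => [e|e|ne1 ne2].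
- by move: (congr1 val e) => /=; rewrite IH2; if_lia.
- by move: (congr1 val e) => /=; rewrite IH2; if_lia.
- have {}ne1: (tau n k.+1 x).2 <> k :> nat by move=> e; apply: ne1; apply: val_inj.
  have {}ne2: (tau n k.+1 x).2 <> k.+1 :> nat.
    by move=> e; apply: ne2; apply: val_inj.
  by move: ne1 ne2; rewrite IH2; if_lia.
Qed.

Lemma tau_rot n k : k <= n -> tau n k \in rotgp n k.
Proof.
move=> kn; apply/rotgpP; split.
  apply/parabP; split=> [|x kx]; first exact: tau_Bn.
  have [t1 t2] := tauE x kn; apply: letterP; rewrite ?t1 ?t2; last by if_lia.
  by have -> : (x.2 == 0 :> nat) && (0 < k) = false; [lia | rewrite addbF].
move=> x y xk yk; rewrite /cyc; have [-> ->] := tauE x kn.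
have [-> ->] := tauE y kn.
rewrite xk yk (leq_ltn_trans _ xk) // !andbT.
set a := nat_of_ord x.2 in xk *; set b := nat_of_ord y.2 in yk *.
(* The shift alters the comparison of two indices exactly when one of them alone is 0, and the sign
   change of that letter compensates. *)
have -> : ((if a == 0 then k.-1 else a.-1) < (if b == 0 then k.-1 else b.-1))
   = (a < b) (+) (a == 0) (+) (b == 0) by if_lia.
by case: (a < b) (a == 0) (b == 0) x.1 y.1 => [] [] [] [] [].
Qed.

(** Up to the exponent [k] a letter passes index 0, where the sign changes, at most once. *)
Lemma tau_expE n k j b (i m : 'I_n) : k <= n -> i < k -> j <= k ->
  m = (if j <= i then i - j else i + k - j) :> nat ->
  (tau n k ^+ j) (b, i) = (b (+) (i < j), m).
Proof.
move=> kn ik; elim: j m => [|j IH] m jk em.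
  by rewrite perm1 addbF; congr (_, _); apply: val_inj; rewrite [RHS]em subn0.
have m'n : (if j <= i then i - j else i + k - j) < n.
  by have := ltn_ord i; if_lia.
rewrite expgSr permM (IH (Ordinal m'n)) ?(ltnW jk) //.
have [t1 t2] := tauE (b (+) (i < j), Ordinal m'n) kn.
apply: letterP; rewrite ?t1 ?t2 /= ?em; last by case: (ltngtP j i) => ?; if_lia.
rewrite -addbA; congr (_ (+) _).
by case: (ltngtP i j); lia.
Qed.

Lemma tau_expkE n k (x : letter n) : k <= n ->
  (tau n k ^+ k) x = if x.2 < k then lopp x else x.
Proof.
move=> kn; case: ifP => [xk|/negbT]; last first.
  have : tau n k ^+ k \in rotgp n k by rewrite groupX ?tau_rot.
  by case/rotgpP => /parabP[_ H] _; rewrite -leqNgt => /H.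
case: x xk => b i /= ik; rewrite (@tau_expE n k k b i i) //; last by if_lia.
by rewrite ik addbT.
Qed.

Lemma expgz_tau_rot n k e : k <= n -> expgz (tau n k) e \in rotgp n k.
Proof. by case: e => e /tau_rot kr; rewrite ?groupV groupX. Qed.

(** * Generalized standard OGS presentations with bounded subscripts *)

(** The allowed exponents are as many as the letters of index at most [q]: the nonnegative ones
    reach the positive letters, the negative ones the negative letters. *)
Lemma tau_transitive n q (y : letter n) (qn : q < n) : y.2 <= q ->
  exists e : int, (- (q.+1%:Z) <= e < q.+1%:Z)%R /\
    expgz (tau n q.+1) e (false, Ordinal qn) = y.
Proof.
case: y => -[] m /= mq.
  (* [Negz m] is $-(m+1)$; the power $m+1$ takes the negative letter of index [m] through index 0 to
     the positive letter of index [q]. *)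
  exists (Negz m); split; first by lia.
  have /= E := @tau_expE n q.+1 m.+1 true m (Ordinal qn) qn mq mq.
  by rewrite /= -(permK (tau n q.+1 ^+ m.+1) (true, m)) E ?ltnn ?ltnSn //=; lia.
exists (Posz (q - m)); split; first by lia.
rewrite /= (@tau_expE n q.+1 (q - m) false (Ordinal qn) m) //=; try if_lia.
by have -> : (q < q - m) = false by lia.
Qed.

(** With all signs kept, [h] is increasing on the first [q] indices, which it permutes. The
    induction shows first that the top index is fixed. *)
Lemma rigid n q (h : {perm letter n}) :
  h \in parab n q -> (forall x : letter n, (h x).1 = x.1) -> cyc_mono q h ->
  h = 1.
Proof.
elim: q => [|q IH] hq hpos hmono; first exact: parab0.
apply: IH => // [|x y xq yq]; last by rewrite hmono // ltnW.
have [hB hfix] := parabP hq; apply/parabP; split=> // x.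
rewrite leq_eqVlt => /orP[/eqP qx|/hfix //]; apply: letterP => //.
have := parab_lt (x := x) hq; rewrite -qx leqnn ltnS leq_eqVlt => /(_ isT).
case/orP=> [/eqP //|hxq].
(* If the top letter [x] moved down, then the letter [y] sent to [x] would have a smaller index than
   [x] but a larger image. *)
have [y hy] : exists2 y, h y = x & y.2 < q.+1.
  exists (h^-1 x); first by rewrite permKV.
  by apply: parab_lt (groupVr hq) _; rewrite -qx.
rewrite ltnS leq_eqVlt => yq1.
have y1 : y.1 = x.1 by rewrite -(hpos y) hy.
have yq : y.2 < q.
  case/orP: yq1 => [/eqP yq|//].
  have yx : y = x by apply: letterP; rewrite ?y1 // -qx.
  by move: hxq; rewrite yx in hy; rewrite hy -qx ltnn.
have := hmono y x (ltnW yq); rewrite -qx leqnn hy /cyc -qx yq y1 hpos.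
by rewrite ltnNge (ltnW hxq) => /(_ isT); case: x.1.
Qed.

(** * The subgroup $\dot S_n$ as the group of sign-preserving elements *)

Definition pos n : {set {perm letter n}} :=
  [set g in Bn n | [forall x : letter n, (g x).1 == x.1]].

Lemma posP n (g : {perm letter n}) :
  reflect (g \in Bn n /\ forall x : letter n, (g x).1 = x.1) (g \in pos n).
Proof.
apply: (iffP setIdP) => [[-> /forallP H]|[-> H]]; split=> //.
  by move=> x; apply/eqP.
by apply/forallP=> x; apply/eqP.
Qed.
Arguments posP {n g}.

Lemma pos_group_set n : group_set (pos n).
Proof.
apply/group_setP; split; first by apply/posP; split=> // x; rewrite perm1.
move=> g h /posP[gB gP] /posP[hB hP]; apply/posP; split; first exact: groupM.
by move=> x; rewrite permM hP gP.
Qed.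
Canonical pos_group n := Group (pos_group_set n).

(* Multiplying by [cgen] on the right moves the image of the last nonfixed
   letter up by one. *)
Lemma pos_parab_dotS n q (g : {perm letter n}) :
  q <= n -> g \in pos n -> g \in parab n q -> g \in dotS n.
Proof.
elim: q g => [|q IH] g qn gpos gq; first by rewrite (parab0 gq) group1.
pose x0 : letter n := (false, Ordinal qn).
(* Inner induction on how far the image of the top letter [x0] lies below its own index [q]. *)
have [d] := ubnP (q - (g x0).2); elim: d => // d IHd in g gpos gq *.
rewrite ltnS => led.
have := parab_lt (x := x0) gq; rewrite leqnn ltnS leq_eqVlt => /(_ isT).
have [gB gP] := posP gpos; have [_ gfix] := parabP gq.
case/orP=> [/eqP gx0|mq].
  apply: IH => //; first exact: ltnW.
  apply/parabP; split=> // -[b i] /=; rewrite leq_eqVlt => /orP[/eqP qi|qi].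
    have -> : i = Ordinal qn by apply: val_inj.
    by apply: letterP; rewrite ?gP // Bn_index.
  exact: gfix.
have mn : (g x0).2.+1 < n by lia.
pose c := cgen (Ordinal mn).
have cS : c \in dotS n by apply/mem_gen/imset_f; rewrite inE.
have cE x : c x = (x.1, tperm (ordpred (Ordinal mn)) (Ordinal mn) x.2).
  exact: cgenSE.
rewrite -(groupMr _ cS); apply: IHd.
- rewrite groupM //; apply/posP; split; first exact: cgen_Bn.
  by move=> x; rewrite cE.
- rewrite groupM //; apply/parabP; split; first exact: cgen_Bn.
  move=> x qx; rewrite cE; apply: letterP => //=.
  apply/congr1/tpermD;
    by rewrite -val_eqE neq_ltn /= ?(leq_ltn_trans mq) ?(ltn_trans mq).
- have gx0 : (g x0).2 = ordpred (Ordinal mn) by apply: val_inj.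
  by rewrite permM cE (etrans (congr1 _ gx0) (tpermL _ _)) /= subnSK.
Qed.

Lemma dotSE n : dotS n = pos n :> {set _}.
Proof.
apply/eqP; rewrite eqEsubset gen_subG; apply/andP; split.
  apply/subsetP=> _ /imsetP[i i0 ->]; apply/posP; split; first exact: cgen_Bn.
  by move=> x; rewrite cgenSE.
apply/subsetP=> g gpos; apply: (@pos_parab_dotS n n) => //.
by rewrite parab_full; case/posP: gpos.
Qed.

Lemma dotSP n (g : {perm letter n}) :
  reflect (g \in Bn n /\ forall x : letter n, (g x).1 = x.1) (g \in dotS n).
Proof. by rewrite dotSE; apply: posP. Qed.
Arguments dotSP {n g}.

Lemma gsOGS_rcons n (g : {perm letter n}) w q e :
  gsOGS g w -> {in w, forall f, f.1 <= q} -> q < n ->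
  (- (q.+1%:Z) <= e < q.+1%:Z)%R -> e != 0%R ->
  gsOGS (g * expgz (tau n q.+1) e) (rcons w (q.+1, e)).
Proof.
move=> [wsort wP ->] wq qn eq e0; split.
- move: wsort; rewrite /unzip1 map_rcons !sorted_pairwise; try exact: ltn_trans.
  rewrite pairwise_rcons => ->; rewrite andbT all_map.
  by apply/allP=> f /wq fq; rewrite /= ltnS.
- by move=> f; rewrite mem_rcons inE => /orP[/eqP ->|/wP].
- by rewrite -cats1 big_cat big_seq1.
Qed.

(** Factors are split off on the right, the largest subscript first. A power of $\tau_{q+1}$ is
    chosen to agree with [h] on the letter of index [q]; dividing by it leaves an element of $B_q$
    that is still monotone on the first [p] letters. *)
Lemma cyc_mono_gsOGS n p q (h : {perm letter n}) :
  p <= n -> q <= n -> h \in parab n q -> cyc_mono p h ->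
  exists2 w, gsOGS h w & {in w, forall f, p <= f.1 <= q}.
Proof.
move=> pn; elim: q h => [|q IH] h qn hq hmono.
  by exists [::] => //; split; rewrite ?big_nil // (parab0 hq).
have [hB hfix] := parabP hq.
have [qp|pq] := ltnP q.+1 p.
  suff -> : h = 1 by exists [::] => //; split; rewrite ?big_nil.
  apply: (rigid hq) => [x|x y xq yq]; last first.
    by apply: hmono; apply: leq_trans qp; apply: ltnW.
  have [qx|xq] := ltnP q x.2; first by rewrite hfix.
  have q1n : q.+1 < n := leq_trans qp pn.
  (* This letter is fixed by [h] and still has index below [p], so comparing any smaller letter with
     it shows that [h] keeps signs. *)
  pose y : letter n := (false, Ordinal q1n).
  have /= := hmono x y (leq_ltn_trans xq (ltnW qp)) qp.
  have hx : (h x).2 < q.+1 := parab_lt hq xq.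
  rewrite (hfix y) // /cyc /= hx (xq : x.2 < q.+1).
  by case: x.1 (h x).1 => [] [].
pose x0 : letter n := (false, Ordinal qn).
have [|e [eq ex0]] := @tau_transitive n q (h x0) qn.
  by rewrite -ltnS; apply: parab_lt hq _ => /=.
set t := expgz _ e in ex0.
have tr : t \in rotgp n q.+1 by apply: expgz_tau_rot.
have /rotgpP[tq tmono] := groupVr tr.
have hE : h = h * t^-1 * t by rewrite mulgKV.
have [||w wh wpq] := IH (h * t^-1) (ltnW qn).
- apply/parabP; split; first by rewrite groupM // (parab_Bn tq).
  have hq1 : h * t^-1 \in parab n q.+1 by rewrite groupM.
  have [/BnP htB htfix] := parabP hq1.
  have htx0 : (h * t^-1) x0 = x0 by rewrite permM -ex0 permK.
  move=> x; rewrite leq_eqVlt => /orP[/eqP qx|]; last exact: htfix.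
  have [->|->] // : x = x0 \/ x = lopp x0; last by rewrite htB htx0.
  by case: x qx => [[] i] /= qi; [right|left]; apply: letterP.
- exact: (cyc_monoM pq).
(* Factors with exponent 0 must be omitted from the presentation. *)
have [e0|e0] := eqVneq e 0%R.
  exists w; last by move=> f /wpq; lia.
  by move: wh; rewrite /t e0 invg1 mulg1.
exists (rcons w (q.+1, e)).
  by rewrite hE; apply: gsOGS_rcons => // f /wpq/andP[].
by move=> f; rewrite mem_rcons inE => /orP[/eqP -> /=|/wpq]; lia.
Qed.

(** Converse of [cyc_mono_gsOGS]. The first subscript is the smallest: its factor rotates the
    letters below it, and the remaining factors are monotone there, so the induction raises [p] to
    that subscript. *)
Lemma gsOGS_cyc_mono n p q (h : {perm letter n}) w :
  gsOGS h w -> {in w, forall f, p <= f.1 <= q} ->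
  h \in parab n q /\ cyc_mono p h.
Proof.
case=> wsort wP -> {h}; elim: w p wsort wP => [|f w IH] p wsort wP wpq.
  by rewrite big_nil; split=> [|x y _ _]; [apply: group1 | rewrite !perm1].
have fw g : g \in w -> g \in f :: w by rewrite inE => ->; rewrite orbT.
have /andP[pf fq] := wpq f (mem_head _ _).
have [/andP[_ fn] _ _] := wP f (mem_head _ _).
have /rotgpP[tq tmono] := @expgz_tau_rot n f.1 f.2 fn.
have [||g gw|Bq mono] := IH f.1; first exact: path_sorted wsort.
- by move=> g /fw /wP.
- have := order_path_min ltn_trans wsort; rewrite all_map => /allP/(_ g gw) /=.
  by have /andP[_ ->] := wpq g (fw g gw); rewrite andbT; apply: ltnW.
rewrite big_cons; split; first by rewrite groupM // (parabS fq).
by apply: (cyc_monoM pf tq) => // x y xp yp; apply: tmono; apply: leq_trans pf.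
Qed.

(** * Blocks u_j *)

(** The condition on $u_j$ freed from words, with $p=p_{j-1}$ and $q=p_j$; [block_gsOGS] translates
    it. *)
Definition block n p q (u : {perm letter n}) :=
  [/\ u \in dotS n, u \in parab n q & cyc_mono p u].

Lemma path_ltn_bounds (x : nat) s y :
  path ltn x s -> y \in x :: s -> x <= y <= last x s.
Proof.
elim: s x y => [|z s IH] x y /=; first by rewrite inE => _ /eqP->; rewrite leqnn.
case/andP=> xz zs; rewrite inE => /orP[/eqP->|/(IH z y zs)/andP[zy ->]].
  have /andP[_ zl] := IH z z zs (mem_head _ _).
  by rewrite leqnn (leq_trans (ltnW xz)).
by rewrite andbT (leq_trans (ltnW xz)).
Qed.

Lemma block_gsOGS n p q (u : {perm letter n}) : p <= n -> q <= n ->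
  block p q u <->
  u \in dotS n /\ (u = 1 \/
    exists f w, [/\ gsOGS u (f :: w), p <= f.1 & (last f w).1 <= q]).
Proof.
move=> pn qn; split=> [[uS uq up]|[uS]].
  split=> //; have [[|f w] uw wpq] := cyc_mono_gsOGS pn qn uq up.
    by left; case: uw => _ _ ->; rewrite big_nil.
  right; exists f, w; split=> //; first by case/andP: (wpq f (mem_head _ _)).
  by case/andP: (wpq _ (mem_last f w)).
case=> [->|[f [w [uw pf wq]]]].
  by split=> [||x y _ _]; rewrite ?group1 ?perm1.
suff [] : u \in parab n q /\ cyc_mono p u by [].
apply: (gsOGS_cyc_mono uw) => g gw; case: uw => wsort _ _.
have /= := path_ltn_bounds wsort (map_f fst gw).
by rewrite last_map => /andP[fg /leq_trans->] //; rewrite (leq_trans pf).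
Qed.

(** Two representatives of one coset of $B_p$ differ by an element of $B_p$ that keeps signs and the
    cyclic order, so [rigid] applies. *)
Lemma block_uniq n p q (g1 g2 u1 u2 : {perm letter n}) :
  g1 \in parab n p -> g2 \in parab n p -> block p q u1 -> block p q u2 ->
  g1 * u1 = g2 * u2 -> u1 = u2.
Proof.
move=> g1p g2p [u1S _ u1m] [u2S _ u2m] e.
suff : u1 * u2^-1 = 1 by move/(canRL (mulgKV _)); rewrite mul1g.
have bp : u1 * u2^-1 \in parab n p.
  suff -> : u1 * u2^-1 = g1^-1 * g2 by rewrite groupM ?groupV.
  by rewrite -(mulgK u2 g2) -e !mulgA mulVg mul1g.
have bS : u1 * u2^-1 \in dotS n by rewrite groupM ?groupV.
apply: (rigid bp) => [|x y xp yp]; first by case/dotSP: bS.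
have u1E z : u1 z = u2 ((u1 * u2^-1) z) by rewrite -permM mulgKV.
by rewrite -u2m ?(parab_lt bp) // -!u1E u1m.
Qed.

(** * Increasing coset representatives, obtained by sorting absolute values *)

Section Sorting.

Variables (n p : nat) (g : {perm letter n}).
Hypotheses (pn : p <= n) (gB : g \in Bn n).

Let s (i : 'I_n) : 'I_n := (g (false, i)).2.

Let s_inj : injective s.
Proof.
move=> i j sij; have /BnP gP := gB.
have [e|ne] := eqVneq (g (false, i)).1 (g (false, j)).1.
  have /perm_inj[//] : g (false, i) = g (false, j).
  by apply: letterP => //; apply: congr1 sij.
suff /perm_inj[] : g (false, i) = g (lopp (false, j)) by [].
rewrite gP; apply: letterP => /=; last exact: congr1 sij.
by case: (g _).1 (g _).1 ne => [] [].
Qed.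

Definition rank (i : 'I_n) := #|[set j : 'I_n | (j < p) && (s j < s i)]|.

Lemma rank_ltn (i : 'I_n) : i < p -> rank i < p.
Proof.
move=> ip; have cp : #|[set j : 'I_n | j < p]| = p.
  by rewrite -sum1dep_card (big_ord_narrow pn) sum1_card card_ord.
rewrite -[X in _ < X]cp; apply: proper_card; apply/properP; split.
  by apply/subsetP=> j; rewrite !inE => /andP[].
by exists i; rewrite !inE ?ltnn ?andbF.
Qed.

Lemma ltn_rank (i j : 'I_n) : i < p -> (rank i < rank j) = (s i < s j).
Proof.
move=> ip; case: (ltnP (s i) (s j)) => sij.
  apply: proper_card; apply/properP; split.
    by apply/subsetP=> k; rewrite !inE => /andP[-> /ltn_trans->].
  by exists i; rewrite !inE ?ip ?ltnn ?andbF.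
apply/negbTE; rewrite -leqNgt; apply/subset_leq_card/subsetP=> k.
by rewrite !inE => /andP[-> /leq_trans->].
Qed.

Lemma rank_ltn_n i : rank i < n.
Proof.
rewrite -[X in _ < X]card_ord -cardsT; apply/proper_card/properP; split=> //.
by exists i; rewrite !inE ?ltnn ?andbF.
Qed.

(** The standardization of [g] on the first [p] letters: signs are kept and absolute values are
    replaced by their ranks. *)
Definition sortf (x : letter n) : letter n :=
  if x.2 < p then ((g x).1, Ordinal (rank_ltn_n x.2)) else x.

Lemma sortf_inj : injective sortf.
Proof.
move=> x y; rewrite /sortf; case: ltnP => xp; case: ltnP => yp //.
- case=> e1 e2; suff e : x.2 = y.2.
    case: x y e {xp yp e2} e1 => [a i] [b j] /= ->.
    by rewrite (Bn_sign a _ gB) (Bn_sign b _ gB) => /addIb->.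
  apply: s_inj; apply: val_inj.
  by case: (ltngtP (s x.2) (s y.2)) => //; rewrite -ltn_rank // e2 ltnn.
- by move=> e; move: yp; rewrite -e /= leqNgt rank_ltn.
- by move=> e; move: xp; rewrite e /= leqNgt rank_ltn.
Qed.

(** The standardization [h] of [g] absorbs all its signs and the relative order of its first [p]
    values, so that what remains is positive and increasing there. *)
Lemma sorting : (forall x : letter n, p <= x.2 -> (g x).1 = x.1) ->
  exists h : {perm letter n},
    [/\ h \in parab n p, forall x : letter n, (h x).1 = (g x).1,
        h^-1 * g \in dotS n & cyc_mono p (h^-1 * g)].
Proof.
move=> gpos; pose h := perm sortf_inj.
have hP : h \in parab n p.
  apply/parabP; split=> [|x]; last by rewrite permE /sortf leqNgt => /negbTE->.
  apply/BnP=> -[b i]; rewrite !permE /sortf /=; case: ifP => // _.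
  by rewrite /lopp /= (elimT BnP gB (b, i)).
have h1 (x : letter n) : (h x).1 = (g x).1.
  by rewrite permE /sortf; case: ltnP => // /gpos->.
exists h; split=> //.
  apply/dotSP; split; first by rewrite groupM ?groupV ?(parab_Bn hP).
  by move=> x; rewrite permM -h1 permKV.
have hVp (x : letter n) : x.2 < p -> (h^-1 x).2 < p by apply/parab_lt/groupVr.
move=> x y /hVp xp /hVp yp; rewrite !permM.
(* At the preimages under [h], whose indices are below [p], the maps [g] and [h] have equal signs
   and order absolute values alike. *)
rewrite -[in RHS](permKV h x) -[in RHS](permKV h y).
case: (h^-1 x) (h^-1 y) xp yp => [a i] [b j] /= ip jp.
rewrite /cyc !h1 (Bn_index a _ gB) (Bn_index b _ gB) -[_ < _](ltn_rank j ip).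
by rewrite !permE /sortf /= ip jp.
Qed.

End Sorting.

(** * The decomposition *)

(* The presentations of the theorem, with [q] as upper bound for the subscripts
   of the last factor; the induction strips the last factors v_(r-1) u_r. *)
Definition decomp n q (g : {perm letter n}) us ps :=
  [/\ size us = (size ps).+1,
      g = (\prod_(0 <= j < size ps)
             (nth 1 us j * tau n (nth 0%N ps j) ^+ nth 0%N ps j))
          * nth 1 us (size ps),
      path ltn 0 ps,
      last 0%N ps <= q
    & forall j, j <= size ps ->
        block (nth 0%N (0%N :: ps) j) (nth q ps j) (nth 1 us j)].

Lemma decomp_nil n q (g : {perm letter n}) us :
  decomp q g us [::] <-> us = [:: g] /\ block 0 q g.
Proof.
split=> [[] | [-> gb]].
  case: us => [|u []] // _ -> _ _ /(_ 0%N isT) /=.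
  by rewrite big_nil mul1g.
by split=> // [|[]] //; rewrite big_nil mul1g.
Qed.

(** Once the last two factors are stripped, the removed subscript [p] replaces [q] as the default of
    [nth], that is, as the upper bound for the new last block. *)
Lemma decomp_rcons n q (g : {perm letter n}) us ps u p :
  decomp q g (rcons us u) (rcons ps p) <->
  exists2 g', decomp p g' us ps /\ last 0%N ps < p <= q
            & block p q u /\ g = g' * tau n p ^+ p * u.
Proof.
have prodE : size us = (size ps).+1 ->
    (\prod_(0 <= j < size (rcons ps p)) (nth 1 (rcons us u) j *
       tau n (nth 0%N (rcons ps p) j) ^+ nth 0%N (rcons ps p) j))
      * nth 1 (rcons us u) (size (rcons ps p)) =
    (\prod_(0 <= j < size ps)
        (nth 1 us j * tau n (nth 0%N ps j) ^+ nth 0%N ps j))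
      * nth 1 us (size ps) * tau n p ^+ p * u.
  move=> sz; rewrite size_rcons big_nat_recr //= !nth_rcons sz !ltnn !eqxx.
  rewrite ltnSn -!mulgA; congr (_ * _).
  apply: eq_big_nat => j /= jlt; rewrite !nth_rcons jlt sz.
  by rewrite (ltn_trans jlt).
have blockE j : j <= size ps -> size us = (size ps).+1 ->
    block (nth 0%N (0%N :: rcons ps p) j) (nth q (rcons ps p) j)
      (nth 1 (rcons us u) j) <->
    block (nth 0%N (0%N :: ps) j) (nth p ps j) (nth 1 us j).
  move=> jle sz; rewrite -rcons_cons !nth_rcons /= sz !ltnS jle.
  case: ltnP => [jlt|jge]; first by rewrite (set_nth_default p q).
  have -> : j = size ps by apply/eqP; rewrite eqn_leq jle.
  by rewrite eqxx (nth_default p).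
have blockE_last : size us = (size ps).+1 ->
    block (nth 0%N (0%N :: rcons ps p) (size ps).+1)
      (nth q (rcons ps p) (size ps).+1) (nth 1 (rcons us u) (size ps).+1) =
    block p q u.
  move=> sz; rewrite -rcons_cons !nth_rcons /= sz !ltnn !eqxx.
  by rewrite ltnNge leqnSn gtn_eqF.
split=> [[sz gE pp lp bl]|[g' [[sz g'E pp lp bl] /andP[lp' pq]] [ub ->]]].
  have {}sz : size us = (size ps).+1 by move: sz; rewrite !size_rcons => -[].
  move: pp lp; rewrite rcons_path last_rcons => /andP[pp lp] pq.
  eexists; last first.
    split; last by rewrite gE prodE.
    by rewrite -(blockE_last sz); apply: bl; rewrite size_rcons.
  split; last by apply/andP; split.
  split=> //; first exact: ltnW.
  by move=> j jle; apply/blockE/bl => //; rewrite size_rcons leqW.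
split.
- by rewrite !size_rcons sz.
- by rewrite prodE // g'E.
- by rewrite rcons_path pp.
- by rewrite last_rcons.
move=> j; rewrite size_rcons leq_eqVlt => /orP[/eqP->|jle].
  by rewrite blockE_last.
by apply/blockE => //; apply: bl.
Qed.

(** This reads $p_{r-1}$ off [g]: $u_r$ keeps signs, $v_{r-1}$ negates exactly the indices below
    $p_{r-1}$, and the factors before it keep the sign at the last of these, their subscripts being
    smaller. *)
Lemma decomp_sign n q (g : {perm letter n}) us ps :
  q <= n -> decomp q g us ps ->
  g \in parab n q /\ forall x : letter n,
    (last 0%N ps <= x.2 -> (g x).1 = x.1) /\
    (x.2.+1 = last 0%N ps -> (g x).1 = ~~ x.1).
Proof.
elim/last_ind: ps q g us => [|ps p IH] q g us qn.
  by case/decomp_nil=> _ [/dotSP[_ gS] gq _]; split.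
case/lastP: us => [[]|us u]; first by rewrite size_rcons.
case/decomp_rcons=> g' [dg' /andP[lp pq]] [[/dotSP[_ uS] uq _] ->].
have pn := leq_trans pq qn; have [g'p g'S] := IH _ _ _ pn dg'.
have /rotgpP[vp _] : tau n p ^+ p \in rotgp n p by rewrite groupX ?tau_rot.
split; first by rewrite !groupM // (parabS pq).
move=> x; rewrite last_rcons !permM uS tau_expkE //; split=> xp.
  by case/parabP: g'p => _ ->; rewrite // ltnNge xp.
rewrite (parab_lt g'p) ?xp //=; congr (~~ _).
by case: (g'S x) => + _; apply; rewrite -ltnS xp.
Qed.

(** Otherwise, by [decomp_sign], the letter just below the larger subscript would be negated
    according to [ps] and keep its sign according to [ps']. An empty list counts as last subscript
    0. *)
Lemma decomp_last_leq n q (g : {perm letter n}) us ps us' ps' :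
  q <= n -> decomp q g us ps -> decomp q g us' ps' ->
  last 0%N ps <= last 0%N ps'.
Proof.
move=> qn d d'; rewrite leqNgt; apply/negP=> lt_l.
have l_n : (last 0%N ps).-1 < n.
  by case: d => _ _ _ lq _; rewrite prednK ?(leq_trans lq) ?(leq_ltn_trans _ lt_l).
have [_ /(_ (false, Ordinal l_n))[_ neg]] := decomp_sign qn d.
have [_ /(_ (false, Ordinal l_n))[+ _]] := decomp_sign qn d'.
have l_gt0 : 0 < last 0%N ps by apply: leq_ltn_trans lt_l.
by rewrite neg /= ?prednK // -ltnS prednK // => /(_ lt_l).
Qed.

Lemma decomp_uniq n q (g : {perm letter n}) us ps us' ps' :
  q <= n -> decomp q g us ps -> decomp q g us' ps' -> us = us' /\ ps = ps'.
Proof.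
elim/last_ind: ps q g us us' ps' => [|ps p IH] q g us us' ps' qn d d'.
all: have := decomp_last_leq qn d' d; have := decomp_last_leq qn d d'.
all: case/lastP: ps' d' => [|ps' p'] d'; rewrite ?last_rcons /=.
- by case/decomp_nil: d d' => -> _ /decomp_nil[-> _].
- case/lastP: us' d' => [[]|us' u'] d'; first by rewrite size_rcons.
  by case/decomp_rcons: d' => g' [_ /andP[lp _]] _ _; case: p' lp.
- case/lastP: us d => [[]|us u] d; first by rewrite size_rcons.
  by case/decomp_rcons: d => g' [_ /andP[lp _]] _; case: p lp.
move=> le_p ge_p; have {le_p ge_p} e : p' = p by apply/eqP; rewrite eqn_leq ge_p.
rewrite {}e {p'} in d' *.
case/lastP: us d => [[]|us u d]; first by rewrite size_rcons.
case/lastP: us' d' => [[]|us' u' d']; first by rewrite size_rcons.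
have [g1 [d1 /andP[_ pq]] [b1 e1]] := (decomp_rcons _ _ _ _ _ _).1 d.
have [g2 [d2 _] [b2 e2]] := (decomp_rcons _ _ _ _ _ _).1 d'.
have pn := leq_trans pq qn.
have /rotgpP[vp _] : tau n p ^+ p \in rotgp n p by rewrite groupX ?tau_rot.
have [[g1p _] [g2p _]] := (decomp_sign pn d1, decomp_sign pn d2).
(* Everything to the left of the last block lies in $B_p$, so the last blocks represent the same
   coset. *)
have eu : u = u'.
  apply: (block_uniq _ _ b1 b2 (etrans (esym e1) e2)); exact: groupM.
have eg : g1 = g2 by move: e1; rewrite e2 eu => /mulIg/mulIg.
rewrite -{}eg in d2.
by have [-> ->] := IH _ _ _ _ _ pn d1 d2; rewrite eu.
Qed.

Lemma tau_expkK n k : k <= n -> tau n k ^+ k * tau n k ^+ k = 1.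
Proof.
move=> kn; apply/permP=> x; rewrite permM perm1 !tau_expkE //.
by case xk: (x.2 < k); rewrite /= xk //; case: x {xk} => [[] i].
Qed.

(** Induction on a bound [m] from which on [g] keeps signs. The bound [q] drops to the new subscript
    whenever a block is split off, and the bound on the last subscript makes the subscripts strictly
    increase. *)
Lemma decomp_exists n m q (g : {perm letter n}) :
  m <= q -> q <= n -> g \in parab n q ->
  (forall x : letter n, m <= x.2 -> (g x).1 = x.1) ->
  exists us ps, decomp q g us ps /\ last 0%N ps <= m.
Proof.
elim: m q g => [|m IH] q g mq qn gq gpos; have gB := parab_Bn gq.
  exists [:: g], [::]; split=> //; apply/decomp_nil; split=> //.
  by split=> //; apply/dotSP; split=> // x; apply: gpos.
have mn := leq_trans mq qn; pose x0 : letter n := (false, Ordinal mn).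
have x0E (x : letter n) : x.2 = m :> nat -> x = (x.1, Ordinal mn).
  by move=> xm; apply: letterP.
have [gm|gm] := boolP (g x0).1; last first.
  have [|us [ps [d l]]] := IH q g (ltnW mq) qn gq.
    move=> x; rewrite leq_eqVlt => /orP[/eqP mx|]; last exact: gpos.
    by rewrite (x0E x) // Bn_sign // (negbTE gm) addbF.
  by exists us, ps; split=> //; apply: leqW.
have [h [hp h1 uS um]] := sorting mn gB gpos.
set v := tau n m.+1 ^+ m.+1; set u := h^-1 * g in uS um.
have /rotgpP[vp _] : v \in rotgp n m.+1 by rewrite groupX ?tau_rot.
(* Like [g], the element [h] negates the letter of index [m]; [v] negates it back, so [h * v] keeps
   signs from [m] on. *)
have [||us [ps [d l]]] := IH m.+1 (h * v) (leqnSn m) mn; first exact: groupM.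
  move=> x; rewrite permM tau_expkE // leq_eqVlt => /orP[/eqP mx|mx].
    rewrite (parab_lt hp) -?mx //= h1 (x0E x) // Bn_sign //= gm.
    by case: x.1.
  by case/parabP: hp => _ -> //; rewrite ltnNge mx.
exists (rcons us u), (rcons ps m.+1); rewrite last_rcons; split=> //.
apply/decomp_rcons; exists (h * v); first by rewrite ltnS l.
split; first by split=> //; rewrite groupM ?groupV // (parabS mq hp).
(* Since [v] is an involution, [h * v * v * u] is [h * u], which is [g]. *)
by rewrite -(mulgA h) /v tau_expkK // mulg1 /u mulKVg.
Qed.

(** * Return to the presentations of the statement *)

Lemma decomp_uv_presentation n (g : {perm letter n}) us ps :
  decomp n g us ps <-> uv_presentation g us ps.
Proof.
split=> [[sz gE pp ln bl]|].
  have psn i : i < size ps -> 0 < nth 0%N ps i <= n.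
    move=> il; have il0 : nth 0%N ps i \in behead (0%N :: ps) by apply: mem_nth.
    have /andP[_ /leq_trans->//] := path_ltn_bounds pp (mem_behead il0).
    rewrite andbT.
    by have /allP := order_path_min ltn_trans pp; apply; apply: mem_nth.
  split; rewrite ?sz //=.
  - by move=> j /bl[].
  - split=> // i j /andP[ij jl]; apply: (sorted_ltn_nth ltn_trans) => //.
    + exact: path_sorted pp.
    + exact: ltn_trans jl.
  move=> j jle; have := bl j jle.
  (* Consing 0 shifts the list, so that entry [j] is the lower bound for block [j], with 0 for the
     first block. *)
  have pn : nth 0%N (0%N :: ps) j <= n.
    by case: j jle {bl} => //= j /psn/andP[].
  have qn : nth n ps j <= n.
    have [jl|jl] := ltnP j (size ps); last by rewrite nth_default.
    by rewrite (set_nth_default 0%N) //; case/andP: (psn j jl).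
  case/(block_gsOGS _ pn qn) => _ [->|[f [w [fw pf wq]]]]; first by left.
  right; exists f, w; split=> //; first by case: j pf {jle pn qn fw wq}.
  by move=> jl; rewrite (set_nth_default n).
case=> sz gE uS [pn pmono] bl; move: gE uS pn pmono bl.
rewrite sz /= => gE uS pn pmono bl.
have pp : path ltn 0%N ps.
  apply/(pathP 0%N) => -[|i] il /=; first by case/andP: (pn 0%N il).
  by apply: pmono; rewrite ltnSn.
have pn0 j : j <= size ps -> nth 0%N (0%N :: ps) j <= n.
  by case: j => //= j /pn/andP[].
split=> //.
  by rewrite -nth_last; case: (ps) pn0 => //= a s H;
    exact: (H (size s).+1).
move=> j jle; apply/block_gsOGS; first exact: pn0.
  have [jl|jl] := ltnP j (size ps); last by rewrite nth_default.
  by rewrite (set_nth_default 0%N) //; case/andP: (pn j jl).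
split; first exact: uS.
case: (bl j jle) => [->|[f [w [fw pf wq]]]]; [by left|right].
exists f, w; split=> //; first by case: j {jle fw wq} pf => //= j ->.
have [jl|jl] := ltnP j (size ps).
  by rewrite (set_nth_default 0%N) //; apply: wq.
(* For the last block the upper bound is the default [n], which bounds every subscript. *)
rewrite nth_default //; case: fw => _ fwP _.
by have [/andP[]] := fwP _ (mem_last f w).
Qed.

Theorem theorem4p0p1 (n : nat) (pi : {perm letter n}) (hpi : pi \in Bn n) :
  exists! d : seq {perm letter n} * seq nat, uv_presentation pi d.1 d.2.
Proof.
(* With [m] and [q] both equal to [n], the sign condition is vacuous. *)
have [||us [ps [d _]]] := @decomp_exists n n n pi (leqnn n) (leqnn n).
- by rewrite parab_full.
- by move=> x; rewrite leqNgt ltn_ord.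
exists (us, ps); split; first exact/decomp_uv_presentation.
case=> us' ps' /decomp_uv_presentation d'.
by have [-> ->] := decomp_uniq (leqnn n) d d'.
Qed.
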